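(* Let $(c_n)_{n\ge0}$, with $c_n\neq0$, be a complex (or real) sequence. If the series $\sum_{n=0}^{\infty}\frac{n!}{\pi^n}c_n$ is absolutely convergent, then $$\left|\sum_{n=0}^{\infty}c_nB_n(z)\right|\leq 2e^{\pi|z|}\sum_{n=0}^{\infty}\frac{n!}{\pi^n}|c_n|,\qquad z\in\mathbb{C}.$$
   Context: $B_n(z)$ denotes the $n$-th Bernoulli polynomial, defined by $\frac{te^{zt}}{e^t-1}=\sum_{n=0}^\infty B_n(z)\frac{t^n}{n!}$ for $|t|<2\pi$. *)

(* Defs.v *)
From Stdlib Require Import Reals Factorial.
From Coquelicot Require Import Coquelicot.

Open Scope C_scope.

(** [C] is Coquelicot's type of complex numbers and [Cmod] its modulus. *)

Definition Cexp (z : C) : C :=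
  ((exp (Re z) * cos (Im z))%R, (exp (Re z) * sin (Im z))%R).

(** Convergence of a complex series, for the usual topology of [C]. *)
Definition is_Cseries (a : nat -> C) (s : C) : Prop :=
  @is_series C_AbsRing C_NormedModule a s.

(** [B n z] is the value at [z] of the n-th Bernoulli polynomial: by uniqueness
    of power series coefficients exactly one [B] satisfies this.  The quotient
    has a removable singularity at [t = 0], where Coquelicot's total division
    would give it the value 0 instead of its limit 1; that point is left out,
    which does not change the coefficients. *)
Definition is_Bernoulli_polynomials (B : nat -> C -> C) : Prop :=
  forall z t : C, t <> RtoC 0 -> (Cmod t < 2 * PI)%R ->
    is_Cseries (fun n => B n z * (t ^ n / RtoC (INR (fact n))))
               (t * Cexp (z * t) / (Cexp t - RtoC 1)).

(* Main.v *)
(** The Taylor coefficients [b_n] of [t / (exp t - 1)] satisfy, by the Riccati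
    equation [t g' = g - t g - g^2], the recurrence
    [(n + 1) b_n = - sum_(2 <= k <= n - 2) b_k b_(n - k)] for [n >= 4].  Since the
    sum has [n - 3] terms, induction gives [|b_n| PI^n <= 1] for [n >= 2], the start
    being [PI^2 <= 12]; as [b_0 = 1] and [b_1 = - 1 / 2], [|b_n| PI^n <= 2] always.
    Writing [B_n(z) / n!] as the Cauchy product [sum_k b_k z^(n - k) / (n - k)!]
    then yields [|B_n(z)| PI^n / n! <= 2 exp (PI |z|)].  Bounding
    [t / (exp t - 1)] on the circle [|t| = PI] instead would only give the constant
    [PI / (1 - exp (- PI)) > 2]. *)

Require Import Defs.
From Stdlib Require Import Reals Factorial Wf_nat Lra Lia.
From Coquelicot Require Import Coquelicot.

Open Scope R_scope.

(** * Complex series: passage to components and domination *)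

Lemma im_le_Cmod (c : C) : Rabs (Im c) <= Cmod c.
Proof. apply Rle_trans with (2 := Rmax_Cmod c), Rmax_r. Qed.

(** Serves for [f = Re] and [f = Im]: additivity carries [f] through partial sums, and the bound by
    [Cmod] carries it through the limit. *)
Lemma is_Cseries_additive (f : C -> R) (a : nat -> C) (s : C) :
  (forall u v : C, f (u + v)%C = f u + f v) -> (forall c, Rabs (f c) <= Cmod c) ->
  is_Cseries a s -> is_series (fun n => f (a n)) (f s).
Proof.
  intros Hadd Hle H.
  apply filterlim_locally; intros eps.
  assert (H' := proj1 (filterlim_locally_ball_norm _ _) H eps).
  revert H'; apply filter_imp; intros n Hn.
  assert (E : sum_n (fun n => f (a n)) n = f (@sum_n C_AbelianMonoid a n)).
  { clear - Hadd. induction n as [|n IH].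
    - now rewrite !sum_O.
    - rewrite !sum_Sn, IH; symmetry; apply Hadd. }
  change (Rabs (sum_n (fun n => f (a n)) n - f s) < eps).
  rewrite E.
  apply Rle_lt_trans with (2 := Hn).
  (* Subtraction comes from additivity alone, as [f (u - s) + f s = f u]. *)
  assert (D : forall u : C, f u - f s = f (u - s)%C).
  { intros u; rewrite <- (Rplus_0_r (f (u - s)%C)), <- (Rplus_opp_r (f s)), <- Rplus_assoc, <- Hadd.
    now replace (u - s + s)%C with u by ring. }
  rewrite D.
  apply Hle.
Qed.

(** Completeness of [C] provides the sum; the triangle inequality on partial sums then passes to the
    limit. *)
Lemma is_Cseries_dominated (a : nat -> C) (b : nat -> R) :
  (forall n, Cmod (a n) <= b n) -> ex_series b ->
  exists s, is_Cseries a s /\ Cmod s <= Series b.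
Proof.
  intros Hab Hb.
  destruct (@ex_series_le C_AbsRing C_CompleteNormedModule a b Hab Hb) as [s Hs].
  exists s; split; [exact Hs|].
  assert (L := filterlim_comp _ _ _ _ _ _ _ _ Hs (@filterlim_norm _ C_NormedModule s)).
  refine (filterlim_le _ _ (Finite (Cmod s)) (Finite (Series b)) _ L (Series_correct b Hb)).
  exists O; intros n _.
  apply Rle_trans with (1 := norm_sum_n_m _ _ _).
  now apply sum_n_m_le.
Qed.

(** * Real power series known on a punctured interval *)

Lemma CV_radius_ge (a : nat -> R) (r : R) :
  ex_pseries a r -> Rbar_le (Rabs r) (CV_radius a).
Proof.
  intros H; apply Rbar_not_lt_le; intros K.
  apply (CV_disk_outside _ _ K), ex_series_lim_0.
  destruct H as [l Hl]; exists l; exact (proj1 (is_pseries_R a r l) Hl).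
Qed.

(** Convergence at the midpoint [u] of [Rabs t] and [r] makes the inequality strict. Since [u > 0]
    even for [t = 0], the puncture does no harm. *)
Lemma CV_radius_gt_of_punctured (a : nat -> R) (f : R -> R) (r : R) :
  (forall t, 0 < Rabs t < r -> is_pseries a t (f t)) ->
  forall t, Rabs t < r -> Rbar_lt (Rabs t) (CV_radius a).
Proof.
  intros H t Ht.
  assert (0 <= Rabs t) by apply Rabs_pos.
  set (u := (Rabs t + r) / 2).
  assert (Hu : Rabs u = u) by (apply Rabs_pos_eq; unfold u; lra).
  apply Rbar_lt_le_trans with (Finite u); [simpl; unfold u; lra|].
  rewrite <- Hu; apply CV_radius_ge.
  exists (f u); apply H; rewrite Hu; unfold u; lra.
Qed.

Lemma is_pseries_lincomb (alpha beta : R) (a b : nat -> R) (t la lb : R) :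
  is_pseries a t la -> is_pseries b t lb ->
  is_pseries (fun n => alpha * a n + beta * b n) t (alpha * la + beta * lb).
Proof.
  intros Ha Hb.
  refine (is_pseries_plus (V := R_NormedModule) _ _ _ _ _
            (is_pseries_scal alpha _ _ _ _ Ha) (is_pseries_scal beta _ _ _ _ Hb));
    apply Rmult_comm.
Qed.

(** Multiplying both series by [t] removes the exception at [t = 0]. *)
Lemma is_pseries_punctured_unique (a b : nat -> R) (f : R -> R) (r : R) :
  0 < r ->
  (forall t, 0 < Rabs t < r -> is_pseries a t (f t)) ->
  (forall t, 0 < Rabs t < r -> is_pseries b t (f t)) ->
  forall n, a n = b n.
Proof.
  intros Hr Ha Hb n.
  assert (R0 : Rabs 0 < r) by now rewrite Rabs_R0.
  change (PS_incr_1 a (S n) = PS_incr_1 b (S n)).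
  apply PSeries_ext_recip.
  - rewrite CV_radius_incr_1, <- Rabs_R0.
    exact (CV_radius_gt_of_punctured a f r Ha 0 R0).
  - rewrite CV_radius_incr_1, <- Rabs_R0.
    exact (CV_radius_gt_of_punctured b f r Hb 0 R0).
  - exists (mkposreal r Hr); intros t Ht.
    change (Rabs (t - 0) < r) in Ht; rewrite Rminus_0_r in Ht.
    rewrite !PSeries_incr_1.
    destruct (Req_dec t 0) as [->|Ht0]; [now rewrite !Rmult_0_l|].
    assert (0 < Rabs t) by now apply Rabs_pos_lt.
    now rewrite (is_pseries_unique _ _ _ (Ha t (conj H Ht))),
      (is_pseries_unique _ _ _ (Hb t (conj H Ht))).
Qed.

(** * The power series of [exp (z t)] in a real variable [t] *)

Definition exp_coef (z : C) (n : nat) : C := (z ^ n / RtoC (INR (fact n)))%C.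

Lemma Cdiv_RtoC (z : C) (x : R) : x <> 0 -> (z / RtoC x)%C = (Re z / x, Im z / x).
Proof.
  intros Hx; destruct z as [u v].
  unfold Cdiv, Cinv, Cmult, RtoC; simpl.
  f_equal; now field.
Qed.

Lemma Cmod_exp_coef (z : C) (n : nat) : Cmod (exp_coef z n) = Cmod z ^ n / INR (fact n).
Proof.
  unfold exp_coef.
  rewrite Cmod_div, Cmod_pow, Cmod_R, Rabs_pos_eq; trivial.
  - apply pos_INR.
  - intros E; apply (INR_fact_neq_0 n); now injection E.
Qed.

Lemma exp_coef_S (z : C) (n : nat) :
  (RtoC (INR (S n)) * exp_coef z (S n))%C = (z * exp_coef z n)%C.
Proof.
  unfold exp_coef.
  rewrite fact_simpl, mult_INR, RtoC_mult; simpl Cpow.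
  field; split; intros E; injection E;
    [apply (INR_fact_neq_0 n) | apply (not_0_INR (S n)); discriminate].
Qed.

(** Coefficient form of [(exp (z t))' = z exp (z t)], split into real and imaginary parts. *)
Lemma Re_Im_exp_coef_S (z : C) (n : nat) :
  PS_derive (fun n => Re (exp_coef z n)) n
    = Re z * Re (exp_coef z n) - Im z * Im (exp_coef z n) /\
  PS_derive (fun n => Im (exp_coef z n)) n
    = Im z * Re (exp_coef z n) + Re z * Im (exp_coef z n).
Proof.
  assert (E := exp_coef_S z n).
  unfold PS_derive.
  assert (E1 := f_equal Re E); assert (E2 := f_equal Im E).
  rewrite !re_mult, re_RtoC, im_RtoC in E1.
  rewrite !im_mult, re_RtoC, im_RtoC in E2.
  lra.
Qed.

(** For each [r >= 0] the terms [a n * r ^ n] are bounded: each is at most one term, hence a partial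
    sum, of the series of [exp (Cmod z * r)]. *)
Lemma CV_radius_infinite_of_exp_coef (a : nat -> R) (z : C) :
  (forall n, Rabs (a n) <= Cmod (exp_coef z n)) -> CV_radius a = p_infty.
Proof.
  intros H.
  apply Rbar_le_antisym.
  - now destruct (CV_radius a).
  - assert (K : forall r, 0 <= r -> Rbar_le r (CV_radius a)).
    { intros r Hr.
      apply (proj1 (CV_radius_bounded a)).
      exists (exp (Cmod z * r)); intros n.
      rewrite Rabs_mult, (Rabs_pos_eq (r ^ n)) by now apply pow_le.
      apply Rle_trans with (Cmod (exp_coef z n) * r ^ n).
      { apply Rmult_le_compat_r; [now apply pow_le | apply H]. }
      rewrite Cmod_exp_coef.
      assert (Hzr : 0 <= Cmod z * r) by (apply Rmult_le_pos; [apply Cmod_ge_0 | easy]).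
      replace (Cmod z ^ n / INR (fact n) * r ^ n)
        with ((Cmod z * r) ^ n / INR (fact n))
        by (rewrite Rpow_mult_distr; unfold Rdiv; ring).
      apply Rle_trans with (2 := exp_ge_taylor _ n Hzr).
      destruct n as [|n]; [simpl; lra|].
      simpl sum_f_R0.
      assert (0 <= sum_f_R0 (fun k => (Cmod z * r) ^ k / INR (fact k)) n).
      { apply cond_pos_sum; intros k.
        apply Rdiv_le_0_compat; [now apply pow_le | apply INR_fact_lt_0]. }
      simpl in *; lra. }
    destruct (CV_radius a) as [c| |]; simpl; trivial.
    + assert (K0 := K (Rabs c + 1)); simpl in K0.
      assert (H0 := Rabs_pos c); assert (H1 := Rle_abs c).
      assert (K1 := K0 ltac:(lra)); lra.
    + exact (K 0 (Rle_refl 0)).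
Qed.

Lemma CV_radius_exp_coef (z : C) :
  CV_radius (fun n => Re (exp_coef z n)) = p_infty /\
  CV_radius (fun n => Im (exp_coef z n)) = p_infty.
Proof.
  split; apply CV_radius_infinite_of_exp_coef with z; intros n.
  - apply re_le_Cmod.
  - apply im_le_Cmod.
Qed.

Lemma eq_of_derive_zero (f : R -> R) :
  (forall t, is_derive f t 0) -> forall t, f t = f 0.
Proof.
  intros H t.
  destruct (Rtotal_order t 0) as [L|[->|L]]; trivial.
  - exact (eq_is_derive f t 0 (fun u _ => H u) L).
  - symmetry; exact (eq_is_derive f 0 t (fun u _ => H u) L).
Qed.

(** The two sums and the two claimed values solve the same linear system
    [u' = p u - q v, v' = q u + p v]; the squared norm of the difference of two
    solutions, damped by [exp (- 2 p t)], is constant. *)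
Lemma exp_coef_sums (z : C) (t : R) :
  is_pseries (fun n => Re (exp_coef z n)) t (Re (Cexp (z * RtoC t))) /\
  is_pseries (fun n => Im (exp_coef z n)) t (Im (Cexp (z * RtoC t))).
Proof.
  destruct (CV_radius_exp_coef z) as [RU RV].
  assert (DUV := Re_Im_exp_coef_S z).
  set (u := fun n => Re (exp_coef z n)) in *.
  set (v := fun n => Im (exp_coef z n)) in *.
  set (p := Re z) in *; set (q := Im z) in *.
  assert (CU : forall t, is_pseries u t (PSeries u t)).
  { intros x; apply PSeries_correct, CV_radius_inside; now rewrite RU. }
  assert (CV : forall t, is_pseries v t (PSeries v t)).
  { intros x; apply PSeries_correct, CV_radius_inside; now rewrite RV. }
  assert (DU : forall t, is_derive (PSeries u) t (p * PSeries u t - q * PSeries v t)).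
  { intros x.
    replace (p * PSeries u x - q * PSeries v x) with (PSeries (PS_derive u) x).
    - apply is_derive_PSeries; now rewrite RU.
    - apply is_pseries_unique.
      replace (p * PSeries u x - q * PSeries v x)
        with (p * PSeries u x + - q * PSeries v x) by ring.
      apply is_pseries_ext with (2 := is_pseries_lincomb _ _ _ _ _ _ _ (CU x) (CV x)).
      intros n; rewrite (proj1 (DUV n)).
      change (p * u n + - q * v n = p * u n - q * v n); ring. }
  assert (DV : forall t, is_derive (PSeries v) t (q * PSeries u t + p * PSeries v t)).
  { intros x.
    replace (q * PSeries u x + p * PSeries v x) with (PSeries (PS_derive v) x).
    - apply is_derive_PSeries; now rewrite RV.
    - apply is_pseries_unique.
      apply is_pseries_ext with (2 := is_pseries_lincomb _ _ _ _ _ _ _ (CU x) (CV x)).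
      intros n; now rewrite (proj2 (DUV n)). }
  set (d1 := fun t => PSeries u t - exp (p * t) * cos (q * t)).
  set (d2 := fun t => PSeries v t - exp (p * t) * sin (q * t)).
  assert (D1 : forall t, is_derive d1 t (p * d1 t - q * d2 t)).
  { intros x; unfold d1, d2.
    auto_derive.
    - repeat split; trivial. eexists; apply DU.
    - replace (Derive (fun x => PSeries u x) x) with (p * PSeries u x - q * PSeries v x)
        by (symmetry; apply is_derive_unique, DU).
      ring. }
  assert (D2 : forall t, is_derive d2 t (q * d1 t + p * d2 t)).
  { intros x; unfold d1, d2.
    auto_derive.
    - repeat split; trivial. eexists; apply DV.
    - replace (Derive (fun x => PSeries v x) x) with (q * PSeries u x + p * PSeries v x)
        by (symmetry; apply is_derive_unique, DV).
      ring. }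
  set (w := fun t => exp (- 2 * p * t) * (d1 t * d1 t + d2 t * d2 t)).
  assert (DW : forall t, is_derive w t 0).
  { intros x; unfold w.
    auto_derive.
    - repeat split; trivial;
        match goal with
        | |- ex_derive (fun y => d1 y) _ => exact (ex_intro _ _ (D1 x))
        | |- ex_derive (fun y => d2 y) _ => exact (ex_intro _ _ (D2 x))
        end.
    - replace (Derive (fun x => d1 x) x) with (p * d1 x - q * d2 x)
        by (symmetry; apply is_derive_unique, D1).
      replace (Derive (fun x => d2 x) x) with (q * d1 x + p * d2 x)
        by (symmetry; apply is_derive_unique, D2).
      ring. }
  (* The coefficient of index 0 is 1, so [d1] and [d2] vanish at 0 and the constant value of [w] is
     0. *)
  assert (U0 : u 0%nat = 1 /\ v 0%nat = 0).
  { unfold u, v, exp_coef. rewrite Cdiv_RtoC by apply INR_fact_neq_0.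
    simpl; split; field. }
  assert (W0 : w t = 0).
  { rewrite (eq_of_derive_zero w DW t).
    unfold w, d1, d2.
    rewrite !PSeries_0, (proj1 U0), (proj2 U0), !Rmult_0_r, exp_0, cos_0, sin_0; ring. }
  assert (Z : d1 t = 0 /\ d2 t = 0).
  { unfold w in W0.
    apply Rmult_integral in W0; destruct W0 as [W0|W0].
    - assert (P := exp_pos (- 2 * p * t)); lra.
    - split; nra. }
  unfold Cexp, Re, Im; simpl.
  fold (Re z) (Im z); fold p q.
  replace (p * t - q * 0) with (p * t) by ring.
  replace (p * 0 + q * t) with (q * t) by ring.
  unfold d1, d2 in Z; destruct Z as [Z1 Z2].
  replace (exp (p * t) * cos (q * t)) with (PSeries u t) by lra.
  replace (exp (p * t) * sin (q * t)) with (PSeries v t) by lra.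
  split; [apply CU | apply CV].
Qed.

(** * Taylor coefficients of [t / (exp t - 1)] and their recurrence *)

Lemma exp_neq_1 (t : R) : t <> 0 -> exp t - 1 <> 0.
Proof.
  intros Ht E; apply Ht, exp_inv; rewrite exp_0; lra.
Qed.

(** The origin is excluded because [0 / 0 = 0] there, not the limit [1]. *)
Definition is_Bernoulli_expansion (b : nat -> R) (r : R) : Prop :=
  forall t, 0 < Rabs t < r -> is_pseries b t (t / (exp t - 1)).

Section Bernoulli_numbers.

Variables (b : nat -> R) (r : R).
Hypothesis Hr : 0 < r.
Hypothesis Hb : is_Bernoulli_expansion b r.

(** With the denominator cleared, the identity also holds at the origin and can be differentiated on
    the whole interval. *)
Lemma Bernoulli_PSeries_mult (t : R) :
  Rabs t < r -> PSeries b t * (exp t - 1) = t.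
Proof.
  intros Ht.
  destruct (Req_dec t 0) as [->|H0].
  - rewrite exp_0; ring.
  - rewrite (is_pseries_unique _ _ _ (Hb t (conj (Rabs_pos_lt _ H0) Ht))).
    field; now apply exp_neq_1.
Qed.

Lemma Bernoulli_PSeries_derive (t : R) :
  Rabs t < r -> PSeries (PS_derive b) t * (exp t - 1) + PSeries b t * exp t = 1.
Proof.
  intros Ht.
  assert (D := is_derive_PSeries b t (CV_radius_gt_of_punctured b _ r Hb t Ht)).
  assert (D1 : is_derive (fun t => PSeries b t * (exp t - 1)) t
                 (PSeries (PS_derive b) t * (exp t - 1) + PSeries b t * exp t)).
  { auto_derive.
    - repeat split; trivial; eexists; apply D.
    - replace (Derive (fun x => PSeries b x) t) with (PSeries (PS_derive b) t)
        by (symmetry; apply is_derive_unique, D).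
      ring. }
  rewrite <- (is_derive_unique _ _ _ D1).
  apply is_derive_unique.
  apply is_derive_ext_loc with (fun t => t); [|exact (is_derive_id t)].
  assert (P : 0 < r - Rabs t) by lra.
  exists (mkposreal _ P); intros y Hy.
  change (Rabs (y - t) < r - Rabs t) in Hy.
  symmetry; apply Bernoulli_PSeries_mult.
  replace y with ((y - t) + t) by ring.
  apply Rle_lt_trans with (1 := Rabs_triang _ _); lra.
Qed.

(** At [t = 0] the product identity reads [0 = 0]; its derivative there determines [b 0]. *)
Lemma Bernoulli_0 : b 0%nat = 1.
Proof.
  assert (H := Bernoulli_PSeries_derive 0).
  rewrite Rabs_R0, exp_0, !PSeries_0 in H; specialize (H Hr); lra.
Qed.

(** Compares the coefficients of index [S n] in [t g' = g - t g - g^2], where [g = PSeries b] and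
    [PS_incr_1] multiplies by [t]. *)
Lemma Bernoulli_riccati (n : nat) :
  INR (S n) * b (S n) = b (S n) - b n - PS_mult b b (S n).
Proof.
  assert (L : forall t, Rabs t < r -> Rbar_lt (Rabs t) (CV_radius b))
    by exact (CV_radius_gt_of_punctured b _ r Hb).
  (* The factors [1] and [-1] give the right side the shape of [is_pseries_lincomb]. *)
  assert (E : PS_incr_1 (PS_derive b) (S n)
              = 1 * (1 * b (S n) + -1 * PS_incr_1 b (S n)) + -1 * PS_mult b b (S n)).
  { apply is_pseries_punctured_unique
      with (b := fun n => 1 * (1 * b n + -1 * PS_incr_1 b n) + -1 * PS_mult b b n)
           (f := fun t => t * PSeries (PS_derive b) t) (r := r); trivial; intros t Ht.
    - refine (is_pseries_incr_1 (V := R_NormedModule) _ _ _ _).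
      apply PSeries_correct, CV_radius_inside.
      rewrite CV_radius_derive; now apply L.
    - assert (G : is_pseries b t (PSeries b t))
        by (apply PSeries_correct, CV_radius_inside; now apply L).
      replace (t * PSeries (PS_derive b) t)
        with (1 * (1 * PSeries b t + -1 * (t * PSeries b t))
              + -1 * (PSeries b t * PSeries b t)).
      + apply is_pseries_lincomb; [apply is_pseries_lincomb; [exact G|] |].
        * exact (is_pseries_incr_1 _ _ _ G).
        * apply is_pseries_mult; trivial; now apply L.
      + assert (T0 : t <> 0) by (intros ->; rewrite Rabs_R0 in Ht; lra).
        assert (M := Bernoulli_PSeries_mult t (proj2 Ht)).
        assert (D := Bernoulli_PSeries_derive t (proj2 Ht)).
        (* After multiplication by [exp t - 1], each product [g * (exp t - 1)] becomes [t] and the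
           equation turns polynomial. *)
        apply Rmult_eq_reg_r with (exp t - 1); [|now apply exp_neq_1].
        set (g := PSeries b t) in *; set (g' := PSeries (PS_derive b) t) in *.
        set (e := exp t) in *.
        assert (D' : g' * (e - 1) = 1 - g * e) by lra.
        rewrite Rmult_assoc, D'.
        replace ((1 * (1 * g + -1 * (t * g)) + -1 * (g * g)) * (e - 1))
          with (g * (e - 1) - t * (g * (e - 1)) - g * (g * (e - 1))) by ring.
        rewrite M.
        replace (t * (1 - g * e)) with (t - t * (g * (e - 1)) - t * g) by ring.
        rewrite M; ring. }
  change (INR (S n) * b (S n)
          = 1 * (1 * b (S n) + -1 * b n) + -1 * PS_mult b b (S n)) in E.
  lra.
Qed.

Lemma Bernoulli_1 : b 1%nat = - / 2.
Proof.
  assert (H := Bernoulli_riccati 0); assert (H0 := Bernoulli_0).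
  unfold PS_mult in H; simpl in H; rewrite H0 in H; lra.
Qed.

Lemma Bernoulli_2 : b 2%nat = / 12.
Proof.
  assert (H := Bernoulli_riccati 1); assert (H0 := Bernoulli_0); assert (H1 := Bernoulli_1).
  unfold PS_mult in H; simpl in H; rewrite H0, H1 in H; lra.
Qed.

Lemma Bernoulli_3 : b 3%nat = 0.
Proof.
  assert (H := Bernoulli_riccati 2); assert (H0 := Bernoulli_0); assert (H1 := Bernoulli_1).
  assert (H2 := Bernoulli_2).
  unfold PS_mult in H; simpl in H; rewrite H0, H1, H2 in H; lra.
Qed.

(** Two terms are peeled off each end of the convolution of index [m + 4]. The outermost pair gives
    [2 * b (m + 4)]; the next pair gives [2 * b 1 * b (m + 3) = - b (m + 3)], which cancels the
    linear term of the Riccati relation. *)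
Lemma Bernoulli_euler (m : nat) :
  INR (m + 5) * b (m + 4)
  = - sum_f_R0 (fun k => b (k + 2)%nat * b (m - k + 2)%nat) m.
Proof.
  assert (H := Bernoulli_riccati (m + 3)).
  assert (H0 := Bernoulli_0); assert (H1 := Bernoulli_1).
  unfold PS_mult in H.
  replace (S (m + 3)) with (S (S (S (S m)))) in H by lia.
  rewrite 2!tech5 in H.
  rewrite (decomp_sum _ (S (S m))) in H by lia.
  rewrite (decomp_sum _ (pred (S (S m)))) in H by (simpl; lia).
  simpl pred in H.
  rewrite Nat.sub_diag, Nat.sub_0_r in H.
  replace (S (S (S (S m))) - 1)%nat with (m + 3)%nat in H by lia.
  replace (S (S (S (S m))) - S (S (S m)))%nat with 1%nat in H by lia.
  rewrite (sum_eq _ (fun k => b (k + 2)%nat * b (m - k + 2)%nat)) in H.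
  2:{ intros i Hi; f_equal; f_equal; lia. }
  replace (S (S (S (S m)))) with (m + 4)%nat in H by lia.
  replace (S (S (S m))) with (m + 3)%nat in H by lia.
  replace (m + 5)%nat with (S (m + 4)) by lia.
  rewrite S_INR.
  rewrite H0, H1 in H; lra.
Qed.

End Bernoulli_numbers.

(** * Geometric bound on the Taylor coefficients *)

Lemma PI_sqr_le_12 : PI ^ 2 <= 12.
Proof.
  (* The Leibniz partial sum [1 - 1/3 + 1/5 - 1/7 + 1/9] bounds [PI / 4] from above, so
     [PI < 3.34]. *)
  assert (H := proj2 (PI_ineq 2)).
  unfold tg_alt, PI_tg in H; simpl in H.
  assert (P := PI_RGT_0).
  assert (PI <= 3.4) by lra.
  nra.
Qed.

Lemma Bernoulli_bound_ge_2 (b : nat -> R) (r : R) :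
  0 < r -> is_Bernoulli_expansion b r ->
  forall n, (2 <= n)%nat -> Rabs (b n) * PI ^ n <= 1.
Proof.
  intros Hr Hb n.
  assert (P := PI_RGT_0).
  induction n as [n IH] using lt_wf_ind; intros Hn.
  destruct (Nat.eq_dec n 2) as [->|N2].
  { rewrite (Bernoulli_2 b r Hr Hb), Rabs_pos_eq by lra.
    assert (Q := PI_sqr_le_12); lra. }
  destruct (Nat.eq_dec n 3) as [->|N3].
  { rewrite (Bernoulli_3 b r Hr Hb), Rabs_R0; lra. }
  destruct (Nat.le_exists_sub 4 n) as [m [-> _]]; [lia|].
  assert (E := Bernoulli_euler b r Hr Hb m).
  assert (M5 : 0 < INR (m + 5)) by (apply lt_0_INR; lia).
  apply Rmult_le_reg_l with (INR (m + 5)); trivial.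
  rewrite <- Rmult_assoc, <- (Rabs_pos_eq (INR (m + 5))) at 1 by lra.
  rewrite <- Rabs_mult, E, Rabs_Ropp.
  assert (Pm : 0 <= PI ^ (m + 4)) by (apply pow_le; lra).
  (* The indices [k + 2] and [m - k + 2] lie in the range of the induction hypothesis and add up to
     [m + 4], so each of the [m + 1] products is at most 1 once [PI ^ (m + 4)] is split between its
     factors. *)
  apply Rle_trans with (INR (S m)).
  - apply Rle_trans with
      (sum_f_R0 (fun k => Rabs (b (k + 2)%nat * b (m - k + 2)%nat)) m * PI ^ (m + 4)).
    { apply Rmult_le_compat_r; trivial; apply Rsum_abs. }
    rewrite Rmult_comm, scal_sum, <- (Rmult_1_l (INR (S m))), <- sum_cte.
    apply sum_Rle; intros k Hk.
    replace (PI ^ (m + 4)) with (PI ^ (k + 2) * PI ^ (m - k + 2))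
      by (rewrite <- pow_add; f_equal; lia).
    rewrite Rabs_mult.
    assert (I1 := IH (k + 2)%nat ltac:(lia) ltac:(lia)).
    assert (I2 := IH (m - k + 2)%nat ltac:(lia) ltac:(lia)).
    replace (Rabs (b (k + 2)%nat) * Rabs (b (m - k + 2)%nat) * (PI ^ (k + 2) * PI ^ (m - k + 2)))
      with ((Rabs (b (k + 2)%nat) * PI ^ (k + 2)) * (Rabs (b (m - k + 2)%nat) * PI ^ (m - k + 2)))
      by ring.
    rewrite <- (Rmult_1_l 1).
    apply Rmult_le_compat; trivial; apply Rmult_le_pos; try apply Rabs_pos; apply pow_le; lra.
  - rewrite Rmult_1_r; apply le_INR; lia.
Qed.

(** Only index 1 exceeds the bound 1: its value [PI / 2] is at most 2 because [PI <= 4]. *)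
Lemma Bernoulli_bound (b : nat -> R) (r : R) :
  0 < r -> is_Bernoulli_expansion b r -> forall n, Rabs (b n) * PI ^ n <= 2.
Proof.
  intros Hr Hb [|[|n]].
  - rewrite (Bernoulli_0 b r Hr Hb), Rabs_R1; simpl; lra.
  - rewrite (Bernoulli_1 b r Hr Hb), Rabs_Ropp, Rabs_pos_eq by lra.
    assert (Q := PI_4); simpl; lra.
  - assert (Q := Bernoulli_bound_ge_2 b r Hr Hb (S (S n)) ltac:(lia)); lra.
Qed.

(** * Convolution with the exponential coefficients *)

Lemma Cmod_sum_f_R0_le (b : nat -> R) (w : nat -> C) (n : nat) :
  Cmod (sum_f_R0 (fun k => b k * Re (w k)) n, sum_f_R0 (fun k => b k * Im (w k)) n)
  <= sum_f_R0 (fun k => Rabs (b k) * Cmod (w k)) n.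
Proof.
  assert (T : forall k, Cmod (b k * Re (w k), b k * Im (w k)) = Rabs (b k) * Cmod (w k)).
  { intros k; rewrite <- Cmod_R, <- Cmod_mult; f_equal.
    unfold Cmult, Re, Im; simpl; f_equal; ring. }
  induction n as [|n IH]; cbn [sum_f_R0].
  - apply Req_le, T.
  - rewrite <- T.
    apply Rle_trans with (1 := Cmod_triangle (_, _) (_, _)).
    apply Rplus_le_compat_r, IH.
Qed.

(** Splitting [rho ^ n] as [rho ^ k * rho ^ (n - k)] bounds the k-th term by
    [M * (rho * Cmod z) ^ (n - k) / (n - k)!]; these add up to [M] times a partial sum of the
    exponential series. *)
Lemma Cmod_convolution_exp_coef (b : nat -> R) (M rho : R) (z : C) (n : nat) :
  0 <= rho -> (forall k, Rabs (b k) * rho ^ k <= M) ->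
  Cmod (PS_mult b (fun k => Re (exp_coef z k)) n, PS_mult b (fun k => Im (exp_coef z k)) n)
    * rho ^ n
  <= M * exp (rho * Cmod z).
Proof.
  intros Hrho HM.
  assert (Hpow : forall k, 0 <= rho ^ k) by (intros k; now apply pow_le).
  assert (M0 : 0 <= M).
  { apply Rle_trans with (2 := HM 0%nat), Rmult_le_pos; [apply Rabs_pos | apply Hpow]. }
  assert (Hz : 0 <= rho * Cmod z) by (apply Rmult_le_pos; [easy | apply Cmod_ge_0]).
  apply Rle_trans with
    (sum_f_R0 (fun k => Rabs (b k) * Cmod (exp_coef z (n - k))) n * rho ^ n).
  { apply Rmult_le_compat_r; trivial.
    exact (Cmod_sum_f_R0_le b (fun k => exp_coef z (n - k)) n). }
  apply Rle_trans with
    (M * sum_f_R0 (fun k => (rho * Cmod z) ^ k / INR (fact k)) n).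
  2:{ apply Rmult_le_compat_l; trivial; now apply exp_ge_taylor. }
  (* Reverses the exponential sum so that its terms carry the index [n - k]. *)
  rewrite <- (sum_f_R0_skip (fun k => (rho * Cmod z) ^ k / INR (fact k)) n).
  rewrite Rmult_comm, !scal_sum.
  apply sum_Rle; intros k Hk.
  rewrite Cmod_exp_coef, Rpow_mult_distr.
  replace (rho ^ n) with (rho ^ k * rho ^ (n - k))
    by (rewrite <- pow_add; f_equal; lia).
  replace (Rabs (b k) * (Cmod z ^ (n - k) / INR (fact (n - k))) * (rho ^ k * rho ^ (n - k)))
    with (rho ^ (n - k) * Cmod z ^ (n - k) / INR (fact (n - k)) * (Rabs (b k) * rho ^ k))
    by (unfold Rdiv; ring).
  apply Rmult_le_compat_l; trivial.
  apply Rdiv_le_0_compat; [|apply INR_fact_lt_0].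
  apply Rmult_le_pos; [trivial | apply pow_le, Cmod_ge_0].
Qed.

(** * Bernoulli polynomials as convolutions, and their bound *)

Lemma Bernoulli_polynomial_expansion (B : nat -> C -> C) (z : C) (t : R) :
  is_Bernoulli_polynomials B -> 0 < Rabs t < 2 * PI ->
  is_pseries (fun n => Re (B n z) / INR (fact n)) t
    (t / (exp t - 1) * Re (Cexp (z * RtoC t))) /\
  is_pseries (fun n => Im (B n z) / INR (fact n)) t
    (t / (exp t - 1) * Im (Cexp (z * RtoC t))).
Proof.
  intros HB Ht.
  assert (T0 : t <> 0) by (intros ->; rewrite Rabs_R0 in Ht; lra).
  assert (H : is_Cseries (fun n => B n z * (RtoC t ^ n / RtoC (INR (fact n))))%C
                (RtoC t * Cexp (z * RtoC t) / (Cexp (RtoC t) - RtoC 1))%C).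
  { apply HB; [intros E; now injection E | rewrite Cmod_R; easy]. }
  (* For real [t] the denominator is real, so the quotient splits into components. *)
  assert (E : (Cexp (RtoC t) - RtoC 1)%C = RtoC (exp t - 1)).
  { unfold Cexp, RtoC, Re, Im; simpl; rewrite cos_0, sin_0.
    unfold Cminus, Cplus, Copp; simpl; f_equal; ring. }
  assert (V : (RtoC t * Cexp (z * RtoC t) / (Cexp (RtoC t) - RtoC 1))%C
              = (t / (exp t - 1) * Re (Cexp (z * RtoC t)),
                 t / (exp t - 1) * Im (Cexp (z * RtoC t)))).
  { rewrite E, Cdiv_RtoC, re_scal_l, im_scal_l by now apply exp_neq_1.
    unfold Rdiv; f_equal; ring. }
  rewrite V in H.
  assert (TN : forall n, (RtoC t ^ n / RtoC (INR (fact n)))%C = RtoC (t ^ n / INR (fact n))).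
  { intros n; rewrite <- RtoC_pow, RtoC_div; trivial; apply INR_fact_neq_0. }
  assert (TR : forall n, Re (B n z * (RtoC t ^ n / RtoC (INR (fact n))))%C
                         = Re (B n z) / INR (fact n) * t ^ n).
  { intros n; rewrite TN, re_scal_r; unfold Rdiv; ring. }
  assert (TI : forall n, Im (B n z * (RtoC t ^ n / RtoC (INR (fact n))))%C
                         = Im (B n z) / INR (fact n) * t ^ n).
  { intros n; rewrite TN, im_scal_r; unfold Rdiv; ring. }
  split; apply is_pseries_R.
  - apply is_series_ext with (1 := TR).
    exact (is_Cseries_additive Re _ _ (fun u v => eq_refl) re_le_Cmod H).
  - apply is_series_ext with (1 := TI).
    exact (is_Cseries_additive Im _ _ (fun u v => eq_refl) im_le_Cmod H).
Qed.

(** At [z = 0] the factor [exp (z t)] is 1; taking real parts yields a real sequence. *)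
Lemma Bernoulli_numbers_expansion (B : nat -> C -> C) :
  is_Bernoulli_polynomials B ->
  is_Bernoulli_expansion (fun n => Re (B n (RtoC 0)) / INR (fact n)) (2 * PI).
Proof.
  intros HB t Ht.
  destruct (Bernoulli_polynomial_expansion B (RtoC 0) t HB Ht) as [H _].
  rewrite Cmult_0_l in H; simpl in H.
  now rewrite exp_0, cos_0, !Rmult_1_r in H.
Qed.

(** Both sides are the coefficients of [t / (exp t - 1) * exp (z t)] on a punctured real interval;
    uniqueness is applied to each component. *)
Lemma Bernoulli_polynomial_convolution (B : nat -> C -> C) (z : C) (n : nat) :
  is_Bernoulli_polynomials B ->
  (B n z / RtoC (INR (fact n)))%C
  = (PS_mult (fun k => Re (B k (RtoC 0)) / INR (fact k)) (fun k => Re (exp_coef z k)) n,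
     PS_mult (fun k => Re (B k (RtoC 0)) / INR (fact k)) (fun k => Im (exp_coef z k)) n).
Proof.
  intros HB.
  assert (R0 : 0 < 2 * PI) by (assert (P := PI_RGT_0); lra).
  assert (Hb := Bernoulli_numbers_expansion B HB).
  destruct (CV_radius_exp_coef z) as [RU RV].
  assert (L := CV_radius_gt_of_punctured _ _ _ Hb).
  rewrite Cdiv_RtoC by apply INR_fact_neq_0.
  f_equal.
  - apply is_pseries_punctured_unique
      with (a := fun n => Re (B n z) / INR (fact n))
           (f := fun t => t / (exp t - 1) * Re (Cexp (z * RtoC t))) (1 := R0); intros t Ht.
    + exact (proj1 (Bernoulli_polynomial_expansion B z t HB Ht)).
    + refine (is_pseries_mult _ _ _ _ _ (Hb t Ht) (proj1 (exp_coef_sums z t)) (L t (proj2 Ht)) _).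
      now rewrite RU.
  - apply is_pseries_punctured_unique
      with (a := fun n => Im (B n z) / INR (fact n))
           (f := fun t => t / (exp t - 1) * Im (Cexp (z * RtoC t))) (1 := R0); intros t Ht.
    + exact (proj2 (Bernoulli_polynomial_expansion B z t HB Ht)).
    + refine (is_pseries_mult _ _ _ _ _ (Hb t Ht) (proj2 (exp_coef_sums z t)) (L t (proj2 Ht)) _).
      now rewrite RV.
Qed.

Lemma Cmod_Bernoulli_polynomial_le (B : nat -> C -> C) (z : C) (n : nat) :
  is_Bernoulli_polynomials B ->
  Cmod (B n z) <= 2 * exp (PI * Cmod z) * (INR (fact n) / PI ^ n).
Proof.
  intros HB.
  assert (P := PI_RGT_0).
  assert (R0 : 0 < 2 * PI) by lra.
  assert (Hb := Bernoulli_numbers_expansion B HB).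
  assert (H := Cmod_convolution_exp_coef _ 2 PI z n (Rlt_le _ _ P) (Bernoulli_bound _ _ R0 Hb)).
  rewrite <- (Bernoulli_polynomial_convolution B z n HB) in H.
  assert (F := INR_fact_lt_0 n).
  assert (Q : 0 < PI ^ n) by now apply pow_lt.
  rewrite Cmod_div, Cmod_R, (Rabs_pos_eq (INR (fact n))) in H.
  - replace (Cmod (B n z)) with (Cmod (B n z) / INR (fact n) * PI ^ n * (INR (fact n) / PI ^ n))
      by (field; split; lra).
    apply Rmult_le_compat_r; trivial.
    now apply Rlt_le, Rdiv_lt_0_compat.
  - lra.
  - intros E; injection E; lra.
Qed.

(** * Summation against the sequence [c] *)

Open Scope C_scope.

Theorem theorem4p2 :
  forall (B : nat -> C -> C), is_Bernoulli_polynomials B ->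
  forall (c : nat -> C),
    (forall n : nat, c n <> RtoC 0) ->
    ex_series (fun n : nat => Cmod (RtoC (INR (fact n) / PI ^ n)%R * c n)%C) ->
  forall z : C,
    exists s : C,
      is_Cseries (fun n : nat => (c n * B n z)%C) s /\
      (Cmod s <= 2 * exp (PI * Cmod z)
                 * Series (fun n : nat => INR (fact n) / PI ^ n * Cmod (c n)))%R.
Proof.
  intros B HB c _ Hc z.
  (* With the constant inside, the right side is the series of termwise bounds that dominates
     [c n * B n z]. *)
  rewrite <- Series_scal_l.
  apply is_Cseries_dominated.
  - intros n.
    rewrite Cmod_mult, Rmult_comm, <- Rmult_assoc.
    apply Rmult_le_compat_r; [apply Cmod_ge_0|].
    now apply Cmod_Bernoulli_polynomial_le.
  - refine (ex_series_scal_l (V := R_NormedModule) _ _ _).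
    revert Hc; apply ex_series_ext; intros n.
    rewrite Cmod_mult, Cmod_R, Rabs_pos_eq; trivial.
    apply Rdiv_le_0_compat; [apply pos_INR | apply pow_lt, PI_RGT_0].
Qed.
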